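(* Let $E$ be a Banach space. The following are equivalent: (a) For every collectionwise normal space $X$ and every l.s.c. convex-valued mapping $\varphi:X\to\mathscr{C}(E)$, $\varphi$ has a continuous selection. (b) For every collectionwise normal space $X$ and every l.s.c. convex-valued mapping $\varphi:X\to\mathscr{C}'(E)$, $\varphi$ has a continuous selection.
   Context: For a topological space $E$, $2^E$ is the family of all nonempty subsets of $E$, $\mathscr{F}(E)$ is the family of all nonempty closed subsets of $E$, $\mathscr{C}(E)$ is the family of all compact members of $\mathscr{F}(E)$, and $\mathscr{C}'(E)=\mathscr{C}(E)\cup\{E\}$. A set-valued mapping $\varphi:X\to 2^E$ is lower semi-continuous (l.s.c.) if $\varphi^{-1}(U)=\{x\in X:\varphi(x)\cap U\neq\varnothing\}$ is open in $X$ for every open $U\subset E$. It is convex-valued if $\varphi(x)$ is convex for every $x\in X$. A map $f:X\to E$ is a selection for $\varphi$ if $f(x)\in\varphi(x)$ for every $x\in X$. A space $X$ is collectionwise normal if it is a $T_1$-space and for every discrete collection $\mathscr{D}$ of closed subsets of $X$ there exists a discrete family $\{U_D:D\in\mathscr{D}\}$ of open subsets of $X$ such that $D\subset U_D$ for every $D\in\mathscr{D}$. (A family of subsets of $X$ is discrete if every point of $X$ has a neighbourhood meeting at most one member of the family.) *)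

(* Defs.v *)
From HB Require Import structures.
From mathcomp Require Import all_boot all_order all_algebra.
From mathcomp Require Import all_classical all_reals all_analysis.

Set Implicit Arguments.
Unset Strict Implicit.
Unset Printing Implicit Defensive.

Import Order.TTheory GRing.Theory Num.Theory.
Import numFieldNormedType.Exports.

Local Open Scope classical_set_scope.
Local Open Scope ring_scope.

(* Discreteness of an indexed family: "at most one member" counts indices, so
   equal nonempty members with different indices are not allowed. A plain
   collection of sets is viewed as the family indexed by itself (F := id). *)
Definition discrete_family (X : topologicalType) (I : Type)
    (D : set I) (F : I -> set X) : Prop :=
  forall x : X, exists2 N : set X, nbhs x N &
    forall i j, D i -> D j ->
      F i `&` N !=set0 -> F j `&` N !=set0 -> i = j.

Definition collectionwise_normal (X : topologicalType) : Prop :=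
  accessible_space X /\
  forall D : set (set X),
    (forall A, D A -> closed A) ->
    discrete_family D id ->
    exists U : set X -> set X,
      [/\ (forall A, D A -> open (U A)),
          (forall A, D A -> A `<=` U A) &
          discrete_family D U].

Definition nonempty_closed_sets (E : topologicalType) : set (set E) :=
  [set A | A !=set0 /\ closed A].

Definition nonempty_compact_sets (E : topologicalType) : set (set E) :=
  [set A | nonempty_closed_sets A /\ compact A].

Definition nonempty_compact_sets_or_full (E : topologicalType) : set (set E) :=
  @nonempty_compact_sets E `|` [set setT].

Definition lsc (X E : topologicalType) (phi : X -> set E) : Prop :=
  forall U : set E, open U -> open [set x | phi x `&` U !=set0].

Definition convex_valued (X : Type) (R : realType) (E : normedModType R)
    (phi : X -> set E) : Prop :=
  forall x : X, convex_set (phi x).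

Definition selection (X E : Type) (phi : X -> set E) (f : X -> E) : Prop :=
  forall x : X, phi x (f x).

(* Main.v *)
(* (b) is proved outright, by Michael's successive approximations. A value
   [phi x] that is not compact is the whole space, hence it contains whatever
   approximation [f x] has been reached so far: [f] has to be improved only on
   the closed set [A] where it is farther than [d] from [phi x], and there
   [phi x] is compact. By Stone's theorem [E] has a locally finite open cover
   [V] of mesh [d], whose preimages under [phi] are point-finite on [A]. In a
   collectionwise normal space a point-finite cover is handled by the strata of
   the points that lie in at most [n] members: new values are patched in stratum
   after stratum, by convex combinations that keep every value already within
   [d] of [phi x]. *)
Require Import Defs.
From HB Require Import structures.
From mathcomp Require Import all_boot all_order all_algebra.
From mathcomp Require Import all_classical all_reals all_analysis.
From mathcomp Require Import lra.

Import Order.TTheory GRing.Theory Num.Theory.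
Import numFieldNormedType.Exports.

Local Open Scope classical_set_scope.
Local Open Scope ring_scope.

Set Implicit Arguments.
Unset Strict Implicit.
Unset Printing Implicit Defensive.

(** * Locally finite open covers of small mesh in a normed space *)

Lemma nbhs_normP (R : numFieldType) (E : normedModType R) (x : E) (A : set E) :
  nbhs x A <-> exists2 e, 0 < e & forall y, `|x - y| < e -> A y.
Proof.
rewrite -nbhs_ballE; split => -[e e0 eA]; exists e => // y.
  by move=> xy; apply: eA; rewrite -ball_normE.
by rewrite -ball_normE; exact: eA.
Qed.

(* Stone's theorem. The n-th layer consists of the sets [D y n], which lie at
   mutual distance at least [1 / (n + 1)]; removing from it the closed set
   [L (n - 1)] of points well inside the previous layers makes the union of all
   layers locally finite. *)
Lemma locally_finite_ball_refinement (R : realType) (E : normedModType R)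
    (r : R) (r0 : 0 < r) :
  exists V : E * nat -> set E,
    [/\ forall j, open (V j),
        forall j x, V j x -> `|j.1 - x| < r,
        forall x, exists j, V j x &
        forall x : E, exists2 N, nbhs x N &
          exists l : seq (E * nat), forall j, V j `&` N !=set0 -> j \in l].
Proof.
have [le_wo wo] := wochoice.well_ordering_principle E.
pose h (n : nat) : R := n.+1%:R^-1.
have h0 n : 0 < h n by rewrite invr_gt0.
have h_anti m n : (m <= n)%N -> h n <= h m.
  by move=> mn; rewrite lef_pV2 ?posrE // ler_nat ltnS.
have h_small e : 0 < e -> exists n, h n < e.
  by move=> /ltr_add_invr[n]; rewrite add0r; exists n.
pose C (y x : E) := `|y - x| < r.
(* [y] is the first centre whose [r]-ball contains [x]. The margin [3 * h n] absorbs the three hops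
   [x], [z], [z'], [x'] in [D_sep], which puts each of [x], [x'] in the ball of the other's
   centre. *)
pose T y n x := [/\ C y x, (forall z, C z x -> le_wo y z) &
  forall w, `|x - w| < 3 * h n -> C y w].
pose D y n z := exists2 x, T y n x & `|x - z| < h n.
pose L n z := forall w, `|z - w| < h n ->
  exists y i, (i <= n)%N /\ D y i w.
have D_sep n y y' z z' : D y n z -> D y' n z' -> `|z - z'| < h n -> y = y'.
  move=> [x [Cx minx xn] xz] [x' [Cx' minx' xn'] xz'] zz'.
  have xx' : `|x - x'| < 3 * h n.
    have := ler_distD z x x'; have := ler_distD z' z x'.
    by rewrite (distrC z' x'); lra.
  have yy' : le_wo y y' by apply: minx; apply: xn'; rewrite distrC.
  have y'y : le_wo y' y by apply: minx'; apply: xn.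
  (* [wo] speaks of unique minima only: a singleton gives reflexivity, and in the pair [y], [y']
     both are minimal, hence equal. *)
  have refl u : le_wo u u.
    have [|v [[]]] := wo (pred1 u); first by exists u; rewrite inE.
    by rewrite inE => /eqP -> + _; apply; rewrite inE.
  have [|v [_ uniq]] := wo (pred2 y y'); first by exists y; rewrite inE eqxx.
  transitivity v; [symmetry|]; apply: uniq; split; rewrite ?inE ?eqxx ?orbT //.
    by move=> w; rewrite !inE => /orP[] /eqP ->.
  by move=> w; rewrite !inE => /orP[] /eqP ->.
have D_cover x : exists y n, D y n x.
  have [|y [[]]] := wo (fun z => `[< C z x >]).
    by exists x; rewrite unfold_in; apply/asboolP; rewrite /C subrr normr0.
  rewrite unfold_in => /asboolP Cyx miny _.
  have [n hn] : exists n, 3 * h n < r - `|y - x|.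
    have [|n hn] := h_small ((r - `|y - x|) / 3).
      by rewrite divr_gt0 // subr_gt0.
    by exists n; lra.
  exists y, n; exists x; last by rewrite subrr normr0.
  split => // [z Czx|w xw]; first by apply: miny; rewrite unfold_in; exact/asboolP.
  by rewrite /C; have := ler_distD x y w; lra.
have D_open y n : open (D y n).
  rewrite openE => z [x Tx xz]; apply/nbhs_normP.
  exists (h n - `|x - z|); first by rewrite subr_gt0.
  move=> w zw; exists x => //.
  by have := ler_distD z x w; lra.
have L_mono m n : (m <= n)%N -> L m `<=` L n.
  move=> mn z Lz w zw; have [|y [i [im Dw]]] := Lz w.
    exact: lt_le_trans (h_anti _ _ mn).
  by exists y, i; split => //; exact: leq_trans mn.
have L_closed n : closed (L n).
  rewrite -openC openE => z /existsNP[w /not_implyP[zw nD]].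
  apply/nbhs_normP; exists (h n - `|z - w|); first by rewrite subr_gt0.
  move=> z' zz' Lz'; apply: nD; apply: Lz'.
  by have := ler_distD z z' w; rewrite (distrC z' z); lra.
have L_cover (x : E) : exists n, nbhs x (L n).
  have [y [n Dx]] := D_cover x.
  have /nbhs_normP[e e0 xe] : nbhs x (D y n).
    by apply: open_nbhs_nbhs; split.
  have [m me] := h_small _ (divr_gt0 e0 (ltr0n R 2)).
  exists (maxn m n); apply/nbhs_normP; exists (e / 2); first exact: divr_gt0.
  move=> z xz w zw; exists y, n; split; first exact: leq_maxr.
  apply: xe; have := ler_distD z x w; have := h_anti _ _ (leq_maxl m n); lra.
pose L' n := if n is k.+1 then L k else set0.
exists (fun j => D j.1 j.2 `\` L' j.2); split.
- move=> [y n]; rewrite setDE; apply: openI => //=; apply: closed_openC.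
  by case: n => [|n] //=; exact: closed0.
- move=> [y n] x [[z [Cz _ zn] zx] _] /=; apply: zn.
  by have := h0 n; lra.
- move=> x.
  (* The first layer containing [x] keeps it: a point of [L' n] already lies in an earlier layer. *)
  have exn : exists n, `[< exists y, D y n x >].
    by have [y [n Dx]] := D_cover x; exists n; apply/asboolP; exists y.
  case: (ex_minnP exn) => n /asboolP[y Dx] nmin.
  exists (y, n); split => //=; case: n Dx nmin => [|n] /= Dx nmin Lx //.
  have [|y' [i [le_in Dx']]] := Lx x; first by rewrite subrr normr0.
  have /nmin : `[< exists y, D y i x >] by apply/asboolP; exists y'.
  by rewrite leqNgt ltnS le_in.
- move=> x; have [n Ln] := L_cover x.
  (* Trimmed layers beyond [n] avoid [L n]. A layer [i <= n] has at most one piece meeting the small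
     ball, whose points are mutually closer than [h n <= h i]. *)
  exists (L n `&` [set z | `|x - z| < h n / 2]).
    apply: filterI => //; apply/nbhs_normP.
    by exists (h n / 2); first exact: divr_gt0.
  pose N := [set z | `|x - z| < h n / 2].
  exists [seq (xget x [set y | D y i `&` N !=set0], i) | i <- iota 0 n.+1].
  move=> [y i] [z [[Dz L'z] [Lz Nz]]]; rewrite /= in Dz L'z.
  have le_in : (i <= n)%N.
    rewrite leqNgt; apply/negP; case: i {Dz} L'z => // i + lt_ni.
    by apply; exact: L_mono Lz.
  apply/mapP; exists i; first by rewrite mem_iota.
  congr pair; set S := [set y | _].
  have [z' [Dz' Nz']] : S (xget x S) by apply: (xgetPex x (P := S)); exists y, z.
  apply: (D_sep _ _ _ _ _ Dz Dz').
  have := ler_distD x z z'; rewrite (distrC z x).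
  by move: Nz Nz' (h_anti _ _ le_in); rewrite /N /=; lra.
Qed.

(** * Convex combinations, gluing of continuous maps, normality *)

Lemma convex_setP (R : realType) (E : normedModType R) (A : set E) :
  convex_set A <->
  forall (t : R) (x y : E), 0 <= t <= 1 -> A x -> A y ->
    A ((1 - t) *: x + t *: y).
Proof.
split=> cA.
  move=> t x y /andP[t0 t1] Ax Ay.
  have := cA y x (Itv01 t0 t1); rewrite !inE => /(_ Ay Ax).
  by congr A; rewrite addrC.
move=> x y t; rewrite !inE => Ax Ay.
have := cA t%:num y x; rewrite ge0 le1 => /(_ isT Ay Ax).
by congr A; rewrite addrC.
Qed.

Lemma normr_conv_lt (R : realType) (E : normedModType R) (t d : R) (x y : E) :
  0 <= t <= 1 -> `|x| < d -> `|y| < d -> `|(1 - t) *: x + t *: y| < d.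
Proof.
move=> /andP[t0 t1] xd yd; apply: le_lt_trans (ler_normD _ _) _.
have t1' : 0 <= 1 - t by rewrite subr_ge0.
rewrite !normrZ (ger0_norm t0) (ger0_norm t1').
set M := Num.max `|x| `|y|; have Md : M < d by rewrite gt_max xd yd.
have xM : `|x| <= M by rewrite le_max lexx.
have yM : `|y| <= M by rewrite le_max lexx orbT.
have := ler_wpM2l t1' xM; have := ler_wpM2l t0 yM; lra.
Qed.

Lemma continuous_local (X Y : topologicalType) (f : X -> Y) :
  (forall x : X, exists2 g : X -> Y, continuous g & \forall z \near x, f z = g z) ->
  continuous f.
Proof.
move=> fg x; have [g cg fgx] := fg x.
rewrite /continuous_at (nbhs_singleton fgx); apply: cvg_trans (cg x).
by apply: near_eq_cvg; near=> z; rewrite (near fgx).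
Unshelve. all: by end_near. Qed.

Lemma collectionwise_normal_normal (X : topologicalType) :
  collectionwise_normal X ->
  forall A B : set X, closed A -> closed B -> A `&` B = set0 ->
    exists U V, [/\ open U, open V, A `<=` U, B `<=` V & U `&` V = set0].
Proof.
move=> [_ cwn] A B cA cB AB0.
(* If [A] and [B] were both empty, the collection would collapse to one set and discreteness could
   not separate [U A] from [U B]. *)
have [A0|A0] := pselect (A = set0).
  by exists set0, setT; rewrite A0 set0I; split => //; [exact: open0|exact: openT].
have [|x|U [oU DU dU]] := cwn [set A; B]; first by move=> _ [] ->.
- have [Ax|nAx] := pselect (A x).
    exists (~` B); first apply: open_nbhs_nbhs.
      split; first exact: closed_openC.
      by move=> Bx; rewrite -[False]/(set0 x) -AB0.
    have id_A K : [set A; B] K -> K `&` ~` B !=set0 -> K = A.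
      by move=> [] -> // [y []].
    by move=> i j Di Dj iN jN; rewrite (id_A i) // (id_A j).
  exists (~` A); first by apply: open_nbhs_nbhs; split => //; exact: closed_openC.
  have id_B K : [set A; B] K -> K `&` ~` A !=set0 -> K = B.
    by move=> [] -> // [y []].
  by move=> i j Di Dj iN jN; rewrite (id_B i) // (id_B j).
- exists (U A), (U B); split; [apply: oU|apply: oU|apply: DU|apply: DU|];
    [by left|by right|by left|by right|].
  rewrite -subset0 => x [UAx UBx]; have [N /nbhs_singleton Nx dN] := dU x.
  have AB : A = B by apply: dN; [left|right|exists x|exists x].
  by move: AB0; rewrite AB setIid -AB.
Qed.

(** * Patching maps over point-finite covers *)

Section point_finite_patching.
Context {R : realType} {X : topologicalType} {E : normedModType R}.
Hypothesis cwnX : collectionwise_normal X.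

Let normalX := collectionwise_normal_normal cwnX.

Lemma normal_shrinking (C O : set X) : closed C -> open O -> C `<=` O ->
  exists W, [/\ open W, C `<=` W & closure W `<=` O].
Proof.
move=> cC oO CO; have [|U [V [oU oV CU OV UV0]]] := normalX cC (open_closedC oO).
  by rewrite -subset0 => x [/CO].
exists U; split => // x Ux; apply: contrapT => /OV Vx.
have [y [Uy Vy]] := Ux _ (open_nbhs_nbhs (conj oV Vx)).
by rewrite -[False]/(set0 y) -UV0.
Qed.

(** A Urysohn function, 1 on [closure P] and 0 off an open [S] with [closure S] inside [U], slides
    [g] into [y]; near points outside [U] the blend is just [g]. Each value lies on the segment from
    [g x] to [y x], so a convex set containing both ends contains it. *)
Lemma patch_near_closed (g y : X -> E) (H U : set X) : closed H -> open U -> H `<=` U ->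
  continuous g ->
  (forall x : X, U x -> exists2 k : X -> E, continuous k & \forall z \near x, y z = k z) ->
  exists g' P, [/\ continuous g', open P, H `<=` P, P `<=` U &
    [/\ forall x, P x -> g' x = y x,
        forall x, ~ U x -> g' x = g x &
        forall x (B : set E), convex_set B -> B (g x) -> (U x -> B (y x)) ->
          B (g' x)]].
Proof.
move=> cH oU HU cg ylocal.
have [P [oP HP PU]] := normal_shrinking cH oU HU.
have [S [oS PS SU]] := normal_shrinking (@closed_closure _ P) oU PU.
have /(@uniform_separatorP _ R)[q [cq q01 q0 q1]] :
    uniform_separator (~` S) (closure P).
  have /(@normal_separatorP R) sepX : normal_space X by apply/(@normal_openP R).
  apply: sepX.
  - exact: open_closedC.
  - exact: closed_closure.
  - by rewrite -subset0 => x [+ /PS].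
have SsubU : S `<=` U by move=> x Sx; apply: SU; exact: subset_closure.
have q0' x : ~ S x -> q x = 0 by move=> Sx; apply: q0; exists x.
have q1' x : P x -> q x = 1.
  by move=> Px; apply: q1; exists x => //; exact: subset_closure.
exists (fun x => (1 - q x) *: g x + q x *: y x), P; split => //.
- apply: continuous_local => x; have [Ux|nUx] := pselect (U x).
    have [k ck yk] := ylocal x Ux.
    exists (fun x => (1 - q x) *: g x + q x *: k x).
      move=> z; apply: cvgD; apply: cvgZ; [|exact: cg|exact: cq|exact: ck].
      by apply: cvgB; [exact: cvg_cst|exact: cq].
    by near=> z; rewrite (near yk).
  exists g => //.
  have : nbhs x (~` closure S).
    apply: open_nbhs_nbhs; split; last by move=> /SU.
    by apply: closed_openC; exact: closed_closure.
  apply: filterS => z nSz; rewrite q0' ?subr0 ?scale1r ?scale0r ?addr0 //.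
  by move=> Sz; apply: nSz; exact: subset_closure.
- by move=> x Px; apply: SsubU; apply: PS; exact: subset_closure.
- split.
  + by move=> x Px; rewrite q1' // subrr scale0r add0r scale1r.
  + move=> x nUx; rewrite q0' ?subr0 ?scale1r ?scale0r ?addr0 //.
    by move=> /SsubU.
  + move=> x B cB Bg By; have [Ux|nUx] := pselect (U x).
      apply: (convex_setP B).1 => //; last exact: By.
      have /q01 : range q (q x) by exists x.
      by rewrite /= in_itv.
    rewrite q0' ?subr0 ?scale1r ?scale0r ?addr0 //.
    by move=> /SsubU.
Unshelve. all: by end_near. Qed.

(* On [H] the sets of points sharing a given signature [set j | V j x] form a
   discrete family of closed sets: this is where collectionwise normality is
   used beyond normality. *)
Lemma extend_locally_constant (J : eqType) (H : set X)
    (V : J -> set X) (y : J -> E) :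
  closed H -> (forall j, open (V j)) ->
  (forall x, H x -> exists j, V j x) ->
  (forall x : X, H x -> \forall z \near x, H z -> [set j | V j z] = [set j | V j x]) ->
  exists U : set X, exists k : X -> E,
    [/\ open U, H `<=` U,
        forall x : X, U x -> \forall z \near x, k z = k x &
        forall x, U x -> exists2 j, V j x & k x = y j].
Proof.
move=> cH oV covV lcV; pose c x := [set j | V j x].
(* [J] may be empty when [H] is; otherwise a point of [H] supplies the default index [j0] for
   [choice]. *)
have [H0|/set0P[x0 Hx0]] := eqVneq H set0.
  by exists set0, (fun=> 0); rewrite H0; split => //; exact: open0.
pose D := [set K | exists2 x, H x & K = H `&` [set z | c z = c x]].
have [j0 _] := covV _ Hx0.
have DV K : exists j, D K -> K `<=` V j.
  have [[x Hx KE]|nDK] := pselect (D K); last by exists j0.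
  have [j Vjx] := covV _ Hx; exists j => _ z; rewrite KE => -[_ cz].
  by rewrite -[V j z]/(c z j) cz.
have {DV} [jK DV] := choice DV.
have [K [x Hx ->]|x|U [oU DU dU]] := cwnX.2 D.
- rewrite -openC openE => z nKz; rewrite /interior.
  have [Hz|nHz] := pselect (H z).
    apply: filterS (lcV _ Hz) => w cw [Hw cwx]; apply: nKz; split => //=.
    by rewrite -cwx; symmetry; exact: cw.
  have : nbhs z (~` H) by apply: open_nbhs_nbhs; split => //; exact: closed_openC.
  by apply: filterS => w nHw [].
- have [Hx|nHx] := pselect (H x).
    exists [set z | H z -> c z = c x]; first exact: lcV.
    have DE K : D K -> K `&` [set z | H z -> c z = c x] !=set0 ->
        K = H `&` [set z | c z = c x].
      move=> [w Hw ->] [z [[Hz czw] /(_ Hz) czx]].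
      by rewrite -czw czx.
    by move=> K K' DK DK' KN KN'; rewrite (DE K) // (DE K').
  exists (~` H); first by apply: open_nbhs_nbhs; split => //; exact: closed_openC.
  by move=> K K' [w Hw ->] _ [z [[]]].
have UD K K' x : D K -> D K' -> U K x -> U K' x -> K = K'.
  move=> DK DK' Kx K'x; have [N /nbhs_singleton Nx dN] := dU x.
  by apply: dN => //; exists x.
pose k x := y (jK (xget set0 [set K | D K /\ U K x])).
have kE K x : D K -> U K x -> k x = y (jK K).
  move=> DK UKx; rewrite /k; set S := [set K | _].
  have [DK' UK'x] : S (xget set0 S) by apply: (xgetPex _ (P := S)); exists K.
  by rewrite (UD _ _ _ DK' DK UK'x UKx).
(* [U K] may stick out of [V (jK K)]; the intersection secures [V j x] for the index used by [k]. *)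
exists (\bigcup_(K in D) (U K `&` V (jK K))), k; split.
- by apply: bigcup_open => K DK; apply: openI => //; exact: oU.
- move=> x Hx; pose K := H `&` [set z | c z = c x].
  have DK : D K by exists x.
  by exists K => //; split; [exact: DU|exact: DV].
- move=> x [K DK [UKx _]]; rewrite (kE _ _ DK UKx).
  have : nbhs x (U K) by apply: open_nbhs_nbhs; split => //; exact: oU.
  by apply: filterS => z UKz; exact: kE.
- move=> x [K DK [UKx VKx]]; exists (jK K) => //; exact: kE.
Qed.

(* [An n] collects the points of [A] lying in at most [n] of the [V j]; outside a
   neighbourhood of [An n] the signature is locally constant on [An n.+1].
   In the pair [(g, C)] the map is already good near [C] and frozen on [C], so
   the successive maps are locally eventually constant near [A]. *)
Lemma patch_point_finite_cover (J : eqType) (A : set X) (V : J -> set X) (y : J -> E)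
    (Phi : X -> set E) (f : X -> E) :
  closed A -> (forall j, open (V j)) ->
  (forall x, A x -> exists j, V j x) ->
  (forall x, A x -> exists l : seq J, forall j, V j x -> j \in l) ->
  (forall x, convex_set (Phi x)) ->
  (forall j x, V j x -> Phi x (y j)) ->
  continuous f -> (forall x, ~ A x -> Phi x (f x)) ->
  exists2 g, continuous g & forall x, Phi x (g x).
Proof.
move=> cA oV covV finV cPhi VPhi cf fPhi.
pose An n := [set x | A x /\
  forall l : seq J, uniq l -> (forall j, j \in l -> V j x) -> (size l <= n)%N].
have nbhsV (l : seq J) x : (forall j, j \in l -> V j x) ->
    \forall z \near x, forall j, j \in l -> V j z.
  elim: l => [|j l IHl] Vx; first exact: nearW.
  have /IHl Vl : forall i, i \in l -> V i x.
    by move=> i il; apply: Vx; rewrite inE il orbT.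
  have : nbhs x (V j).
    by apply: open_nbhs_nbhs; split => //; apply: Vx; rewrite mem_head.
  apply: filterS2 Vl => z Vlz Vjz i; rewrite inE => /orP[/eqP -> //|]; exact: Vlz.
have An_closed n : closed (An n).
  rewrite -openC openE => x nAx; rewrite /interior.
  have [Ax|nAx'] := pselect (A x).
    have /existsNP[l /not_implyP[ul /not_implyP[Vl sl]]] :
        ~ forall l : seq J, uniq l -> (forall j, j \in l -> V j x) -> (size l <= n)%N.
      by move=> h; apply: nAx.
    by apply: filterS (nbhsV _ _ Vl) => z Vz [_ /(_ l ul Vz)].
  have : nbhs x (~` A) by apply: open_nbhs_nbhs; split => //; exact: closed_openC.
  by apply: filterS => z nAz [].
pose Inv n (p : (X -> E) * set X) := [/\ continuous p.1, closed p.2,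
  An n `<=` p.2^° &
  exists O, [/\ open O, p.2 `<=` O &
    forall x, O x \/ ~ A x -> Phi x (p.1 x)]].
have Inv0 : Inv 0%N (f, set0).
  split => //=; first exact: closed0.
    move=> x [Ax An0]; have [j Vjx] := covV _ Ax.
    have // : (size [:: j] <= 0)%N by apply: An0 => // i; rewrite inE => /eqP ->.
  by exists set0; split => //; [exact: open0|move=> x [//|]; exact: fPhi].
have step (q : nat * ((X -> E) * set X)) : exists p, Inv q.1 q.2 ->
    [/\ Inv q.1.+1 p, q.2.2 `<=` p.2 & forall x, q.2.2 x -> p.1 x = q.2.1 x].
  case: q => n [g C] /=.
  have [/= [cg cC AnC [ O [oO CO gPhi]]]|nInv] := pselect (Inv n (g, C)); last first.
    by exists (g, C) => /nInv.
  (* [O] contains [An n], so points of [H] lie in exactly [n.+1] members. Nearby points of [An n.+1]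
     lie in the same members and have no room for others. *)
  pose H := An n.+1 `&` ~` O.
  have cH : closed H by apply: closedI => //; exact: open_closedC.
  have [||U [k [oU HU klc kV]]] := extend_locally_constant y cH oV.
  + by move=> x [[Ax _] _]; exact: covV.
  + move=> x [[Ax Anx] nOx].
    have nAnx : ~ An n x by move=> /AnC /interior_subset /CO.
    have /existsNP[l /not_implyP[ul /not_implyP[Vl sl]]] :
        ~ forall l : seq J, uniq l -> (forall j, j \in l -> V j x) -> (size l <= n)%N.
      by move=> h; apply: nAnx.
    have sig z : An n.+1 z -> (forall j, j \in l -> V j z) ->
        [set j | V j z] = [set j | j \in l].
      move=> [_ Anz] Vlz; rewrite predeqE => j; split=> [Vjz|]; last exact: Vlz.
      apply: contrapT => /negP jl; apply: sl.
      rewrite -ltnS; apply: (Anz (j :: l)) => /=; first by rewrite jl.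
      by move=> i; rewrite inE => /orP[/eqP -> //|]; exact: Vlz.
    apply: filterS (nbhsV _ _ Vl) => z Vlz [Anz _].
    by rewrite (sig z) // (sig x).
  (* Patching inside [U] minus [C] leaves [g] unchanged on [C]. *)
  have [||x [Ux _]|g' [P [cg' oP HP PU [g'P g'U g'Phi]]]] :=
      patch_near_closed (g := g) (y := k) cH (openI oU (closed_openC cC)).
  + by move=> x Hx; split; [exact: HU|case: Hx => _ + /CO].
  + exact: cg.
  + by exists (cst (k x)); [exact: cst_continuous|exact: klc].
  have kPhi x : U x -> Phi x (k x).
    by move=> /kV[j Vjx ->]; exact: VPhi.
  have oOP : open (O `|` P) by exact: openU.
  have [|W [oW CW WO]] := normal_shrinking (closedU cC (An_closed n.+1)) oOP.
  + move=> x [/CO|Anx]; first by left.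
    by have [Ox|nOx] := pselect (O x); [left|right; exact: HP].
  exists (g', closure W) => _; split => //=.
  + split => //=; first exact: closed_closure.
      move=> x Anx; have Wx : W x by apply: CW; right.
      apply: filterS (@subset_closure _ W) _.
      by apply: open_nbhs_nbhs.
    exists (O `|` P); split => // x OPx.
    have [Px|nPx] := pselect (P x).
      by rewrite g'P //; apply: kPhi; case: (PU _ Px).
    apply: g'Phi => //; last by move=> [Ux _]; exact: kPhi.
    by apply: gPhi; case: OPx => [[]//|]; [left|right].
  + by move=> x Cx; apply: subset_closure; apply: CW; left.
  + by move=> x Cx; apply: g'U => -[].
have {step} [F FP] := choice step.
pose s := fix s n := if n is m.+1 then F (m, s m) else (f, set0).
have sInv n : Inv n (s n).
  elim: n => [|n IHn]; first exact: Inv0.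
  by have [] := FP (n, s n) IHn.
have sS n := FP (n, s n) (sInv n).
have sC m n : (m <= n)%N ->
    (s m).2 `<=` (s n).2 /\ forall x, (s m).2 x -> (s n).1 x = (s m).1 x.
  elim: n => [|n IHn]; first by rewrite leqn0 => /eqP ->; split.
  rewrite leq_eqVlt => /orP[/eqP ->|]; first by split.
  rewrite ltnS => /IHn[mn mnE].
  have [_ nS nSE] := sS n; split; first exact: subset_trans nS.
  by move=> x mx; rewrite nSE ?mnE //; exact: mn.
pose U := \bigcup_n (s n).2^°.
have AU : A `<=` U.
  move=> x Ax; have [l Vl] := finV _ Ax; exists (size l) => //.
  have [_ _ + _] := sInv (size l); apply; split => // l' ul' Vl'.
  by apply: uniq_leq_size => // j /Vl' /Vl.
(* Every stage with [x] in its frozen set gives the same value; the default [0] matters only off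
   [U]. *)
pose N x := xget 0%N [set n | (s n).2^° x].
pose ginf x := (s (N x)).1 x.
have ginfE n x : (s n).2 x -> U x -> ginf x = (s n).1 x.
  move=> nx [m _ mx].
  have /interior_subset Nx : (s (N x)).2^° x.
    by apply: (xgetPex _ (P := [set n | (s n).2^° x])); exists m.
  by have [/sC[_ ->//]|/ltnW/sC[_ <-]] := leqP (N x) n.
have oU : open U by apply: bigcup_open => n _; exact: open_interior.
(* [ginf] is controlled only on [U], so it is blended back into [f] away from [A]. At points of [U]
   outside [A] both maps have values in the convex [Phi x]. *)
have [x [n _ nx]|g [P [cg oP AP PU [gP gU gPhi]]]] := patch_near_closed cA oU AU cf (y := ginf).
  exists (s n).1; first by case: (sInv n).
  have : nbhs x (U `&` (s n).2^°).
    apply: filterI; first by apply: open_nbhs_nbhs; split => //; exists n.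
    by apply: open_nbhs_nbhs; split => //; exact: open_interior.
  by apply: filterS => z [Uz /interior_subset nz]; exact: ginfE.
exists g => // x.
have ginfPhi n : U x -> (s n).2 x \/ ~ A x -> Phi x (ginf x).
  move=> Ux [nx|nAx].
    have [_ _ _ [ O [_ CO OPhi]]] := sInv n.
    by rewrite (ginfE n) //; apply: OPhi; left; exact: CO.
  by have [_ _ _ [ O [_ _ OPhi]]] := sInv (N x); apply: OPhi; right.
have [Ax|nAx] := pselect (A x); last first.
  by apply: gPhi => //; [exact: fPhi|move=> Ux; apply: (ginfPhi 0%N) => //; right].
have [n _ /interior_subset nx] := AU _ Ax.
by rewrite gP; [apply: (ginfPhi n); [exact: AU|left]|exact: AP].
Qed.

End point_finite_patching.

(** * Lower semi-continuity and approximate selections *)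

Lemma compact_locally_finite (T : topologicalType) (J : eqType)
    (V : J -> set T) (K : set T) :
  (forall x : T, exists2 N, nbhs x N &
    exists l : seq J, forall j, V j `&` N !=set0 -> j \in l) ->
  compact K -> exists l : seq J, forall j, V j `&` K !=set0 -> j \in l.
Proof.
move=> lfV /compact_near_coveringP coverK.
(* Along [F] lists grow by inclusion, so the near-covering form of compactness turns local lists
   into one list for all of [K]. *)
pose F : set_system (seq J) :=
  filter_from setT (fun l : seq J => [set l' : seq J | {subset l <= l'}]).
have FF : Filter F.
  apply: filter_from_filter; first by exists [::].
  move=> l l' _ _; exists (l ++ l') => // l'' sub; split=> j jl; apply: sub;
    by rewrite mem_cat jl ?orbT.
have [|l _ Kl] := coverK _ F (fun l x => forall j, V j x -> j \in l) FF.
  move=> x _; have [N xN [l Nl]] := lfV x.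
  exists (N, [set l' | {subset l <= l'}]); first by split => //; exists l.
  by move=> [z l'] [/= Nz sub] j Vjz; apply: sub; apply: Nl; exists z.
by exists l => j [x [Vjx Kx]]; exact: Kl Kx _ Vjx.
Qed.

Lemma lsc_setI_ball (R : realType) (X : topologicalType) (E : normedModType R)
    (phi : X -> set E) (f : X -> E) (e : R) :
  lsc phi -> continuous f ->
  lsc (fun x => phi x `&` [set z | `|f x - z| < e]).
Proof.
move=> lphi cf U oU; rewrite openE => x [z [[phiz fz] Uz]].
(* Half the slack pays for moving [z], half for moving [f x]. *)
rewrite /= in fz; pose d := (e - `|f x - z|) / 2.
have d0 : 0 < d by rewrite divr_gt0 // subr_gt0.
have oB : open (U `&` [set w | `|z - w| < d]).
  apply: openI => //; rewrite openE => w /= zw; apply/nbhs_normP.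
  exists (d - `|z - w|); first by rewrite subr_gt0.
  by move=> v wv; have := ler_distD w z v; move: zw wv; rewrite /mkset; lra.
have near_phi : \forall y \near x, phi y `&` (U `&` [set w | `|z - w| < d]) !=set0.
  apply: open_nbhs_nbhs; split; first exact: lphi.
  by exists z; split => //; split => //=; rewrite subrr normr0.
have /cvgrPdist_lt/(_ d d0) := cf x.
apply: filterS2 near_phi => y [w [phiw [Uw /= zw]]] fxy.
exists w; split => //; split => //=.
have := ler_distD (f x) (f y) w; have := ler_distD z (f x) w.
by move: fxy zw; rewrite (distrC (f y) (f x)) /d; lra.
Qed.

Lemma lsc_meets_ball (R : realType) (X : topologicalType) (E : normedModType R)
    (phi : X -> set E) (f : X -> E) (e : R) :
  lsc phi -> continuous f ->
  open [set x | phi x `&` [set z | `|f x - z| < e] !=set0].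
Proof.
move=> lphi cf; have := lsc_setI_ball e lphi cf openT.
by congr open; apply/funext => x; rewrite /mkset setIT.
Qed.

Lemma convex_setI (R : realType) (E : normedModType R) (A B : set E) :
  convex_set A -> convex_set B -> convex_set (A `&` B).
Proof.
move=> /convex_setP cA /convex_setP cB; apply/convex_setP => t x y t01 [Ax Bx] [Ay By].
by split; [exact: cA|exact: cB].
Qed.

Lemma convex_set_ball (R : realType) (E : normedModType R) (c : E) (e : R) :
  convex_set [set z : E | `|c - z| < e].
Proof.
apply/convex_setP => t x y t01 /= cx cy.
have -> : c - ((1 - t) *: x + t *: y) = (1 - t) *: (c - x) + t *: (c - y).
  by rewrite !scalerBr addrACA -scalerDl subrK scale1r opprD.
exact: normr_conv_lt.
Qed.

Lemma convex_set_thickening (R : realType) (E : normedModType R) (A : set E) (d : R) :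
  convex_set A -> convex_set [set y : E | A `&` [set z | `|y - z| < d] !=set0].
Proof.
move=> /convex_setP cA; apply/convex_setP => t x y t01 [z [Az /= xz]] [w [Aw /= yw]].
exists ((1 - t) *: z + t *: w); split; first exact: cA.
by rewrite /= opprD addrACA -!scalerBr; exact: normr_conv_lt.
Qed.

(* Only the closed set [A] of points where [f] is not yet good enough needs a new
   map; there [psi x] is relatively compact, so it meets finitely many [V j]. *)
Lemma approximate_selection (R : realType) (X : topologicalType)
    (E : normedModType R) (psi : X -> set E) (f : X -> E) (d : R) :
  collectionwise_normal X -> 0 < d ->
  (forall x, psi x !=set0) -> lsc psi -> convex_valued psi -> continuous f ->
  (forall x, psi x (f x) \/ exists2 K, compact K & psi x `<=` K) ->
  exists2 g : X -> E, continuous g &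
    forall x, psi x `&` [set z | `|g x - z| < d] !=set0.
Proof.
move=> cwnX d0 psi0 lpsi cpsi cf fpsi.
have [V [oV Vd Vcov Vlf]] := locally_finite_ball_refinement E d0.
pose A := ~` [set x | psi x `&` [set z | `|f x - z| < d] !=set0].
(* The values patched in are the centres [j.1]: when [psi x] meets [V j], a point of [psi x] lies
   within [d] of [j.1]. *)
apply: (@patch_point_finite_cover R X E cwnX _ A (fun j => [set x | psi x `&` V j !=set0])
  (fun j => j.1) (fun x => [set y | psi x `&` [set z | `|y - z| < d] !=set0]) f) => //.
- by apply: open_closedC; exact: lsc_meets_ball.
- by move=> j; exact: lpsi.
- move=> x _; have [z psiz] := psi0 x; have [j Vjz] := Vcov z.
  by exists j; exists z.
- move=> x Ax; have [fx|[K cK psiK]] := fpsi x.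
    by exfalso; apply: Ax; exists (f x); split => //=; rewrite subrr normr0.
  have [l Kl] := compact_locally_finite Vlf cK.
  by exists l => j [z [/psiK Kz Vjz]]; apply: Kl; exists z.
- by move=> x; exact: convex_set_thickening.
- by move=> j x [z [psiz Vjz]]; exists z; split => //; exact: Vd.
- by move=> x; apply: contrapT.
Qed.

(** * Uniform limits and exact selections *)

Lemma uniform_limit_selection (R : realType) (X : topologicalType)
    (E : completeNormedModType R) (phi : X -> set E) (u : nat -> X -> E) :
  (forall x, closed (phi x)) -> (forall n, continuous (u n)) ->
  (forall n x, phi x `&` [set z | `|u n x - z| < (2 ^ n)%:R^-1] !=set0) ->
  (forall n x, `|u n x - u n.+1 x| <= 2 * (2 ^ n)%:R^-1) ->
  exists f : X -> E, continuous f /\ selection phi f.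
Proof.
move=> clphi cu phiu uS.
pose h n : R := (2 ^ n)%:R^-1.
have hS n : h n = 2 * h n.+1.
  by rewrite /h expnS natrM invfM mulrA divff ?mul1r.
have h0 n : 0 < h n by rewrite invr_gt0 ltr0n expn_gt0.
have h_small e : 0 < e -> exists n, h n < e.
  move=> /ltr_add_invr[n]; rewrite add0r => ne; exists n.
  apply: le_lt_trans ne; rewrite lef_pV2 ?posrE ?ltr0n ?expn_gt0 // ler_nat.
  exact: ltn_expl.
(* As [h m = 2 * h m.+1], the step bound [2 * h m] equals [4 * (h m - h m.+1)] and telescopes. *)
have uD n k x : `|u n x - u (n + k)%N x| <= 4 * (h n - h (n + k)%N).
  elim: k => [|k IHk]; first by rewrite addn0 !subrr normr0 mulr0.
  have := ler_distD (u (n + k)%N x) (u n x) (u (n + k.+1)%N x).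
  have := uS (n + k)%N x; rewrite -/(h _) addnS.
  by have := hS (n + k)%N; lra.
have uE n m x : (n <= m)%N -> `|u n x - u m x| < 4 * h n.
  move=> /subnKC <-; have := uD n (m - n)%N x; have := h0 (n + (m - n))%N; lra.
have ucvg x : cvg (u n x @[n --> \oo]).
  apply: cauchy_cvg; apply: cauchy_exP => e e0.
  have [n ne] := h_small _ (divr_gt0 e0 (ltr0n R 4)).
  exists (u n x); exists n => // m /= nm.
  by rewrite -ball_normE /=; have := uE n m x nm; lra.
pose f x := lim (u n x @[n --> \oo]).
have uf n x : `|u n x - f x| <= 4 * h n.
  apply/ler_addgt0Pr => e e0.
  have /cvgrPdist_lt/(_ e e0)[m _ mf] := ucvg x.
  have : `|f x - u (maxn m n) x| < e by exact: mf (leq_maxl _ _).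
  have := uE n _ x (leq_maxr m n).
  have := ler_distD (u (maxn m n) x) (u n x) (f x).
  by rewrite (distrC (u (maxn m n) x) (f x)); lra.
exists f; split.
  move=> x; apply/cvgrPdist_lt => e e0.
  have [n ne] := h_small _ (divr_gt0 e0 (ltr0n R 16)).
  have /cvgrPdist_lt/(_ _ (divr_gt0 e0 (ltr0n R 2))) := cu n x.
  apply: filterS => z unz.
  have := ler_distD (u n x) (f x) (f z); have := ler_distD (u n z) (u n x) (f z).
  have := uf n x; have := uf n z; rewrite (distrC (f x) (u n x)); lra.
move=> x; apply: clphi => B /nbhs_normP[e e0 eB].
have [n ne] := h_small _ (divr_gt0 e0 (ltr0n R 8)).
have [z [phiz /= unz]] := phiu n x; exists z; split => //; apply: eB.
have := ler_distD (u n x) (f x) z; have := uf n x.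
by move: unz; rewrite -/(h n) (distrC (f x) (u n x)); lra.
Qed.

Theorem selection_compact_or_full (R : realType) (E : completeNormedModType R)
    (X : topologicalType) (phi : X -> set E) :
  collectionwise_normal X ->
  (forall x : X, nonempty_compact_sets_or_full (phi x)) ->
  lsc phi -> convex_valued phi ->
  exists f : X -> E, continuous f /\ selection phi f.
Proof.
move=> cwnX phiC lphi cphi.
pose h n : R := (2 ^ n)%:R^-1.
have h0 n : 0 < h n by rewrite invr_gt0 ltr0n expn_gt0.
pose approx n (g : X -> E) := continuous g /\
  forall x, phi x `&` [set z | `|g x - z| < h n] !=set0.
have [g0 cg0 g0phi] : exists2 g : X -> E, continuous g &
    forall x, phi x `&` [set z | `|g x - z| < h 0%N] !=set0.
  (* A noncompact value is the whole space and contains the starting value [0]. *)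
  apply: (@approximate_selection _ _ _ phi (fun=> 0)) => //.
  - by move=> x; case: (phiC x) => [[[]]//|->]; exists 0.
  - by move=> x; exact: cvg_cst.
  - by move=> x; case: (phiC x) => [[_ cK]|->]; [right; exists (phi x)|left].
have step (q : nat * (X -> E)) : exists g, approx q.1 q.2 ->
    approx q.1.+1 g /\ forall x, `|q.2 x - g x| <= 2 * h q.1.
  case: q => n f /=; have [[cf fphi]|napp] := pselect (approx n f); last first.
    by exists f => /napp.
  (* Cutting [phi x] down to the [h n]-ball about [f x] keeps [g] within [h n + h n.+1 <= 2 * h n]
     of [f]. The cut value lies in the compact [phi x], or contains [f x] when [phi x] is
     everything. *)
  have [|||x|g cg gphi] := @approximate_selection _ _ _
      (fun x => phi x `&` [set z | `|f x - z| < h n]) f _ cwnX (h0 n.+1) fphi.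
  - exact: lsc_setI_ball.
  - by move=> x; apply: convex_setI; [exact: cphi|exact: convex_set_ball].
  - exact: cf.
  - case: (phiC x) => [[_ cK]|phiT]; [right|left].
      by exists (phi x) => // z [].
    by split; [rewrite phiT|rewrite /= subrr normr0].
  exists g => _; split; first split => //.
    by move=> x; have [z [[phiz _] gz]] := gphi x; exists z.
  move=> x; have [z [[_ /= fz] /= gz]] := gphi x.
  have := ler_distD z (f x) (g x); rewrite (distrC z).
  have : h n.+1 <= h n by rewrite lef_pV2 ?posrE ?ltr0n ?expn_gt0 // ler_nat leq_exp2l.
  lra.
have {step} [F FP] := choice step.
pose u := fix u n := if n is m.+1 then F (m, u m) else g0.
have uP n : approx n (u n).
  by elim: n => [|n IHn]; [split|have [] := FP (n, u n) IHn].
apply: (@uniform_limit_selection _ _ _ phi u).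
- by move=> x; case: (phiC x) => [[[]]//|->]; exact: closedT.
- by move=> n; case: (uP n).
- by move=> n; case: (uP n).
- by move=> n; have [] := FP (n, u n) (uP n).
Qed.

Theorem theorem1p2 (R : realType) (E : completeNormedModType R) :
  (forall (X : topologicalType) (phi : X -> set E),
     collectionwise_normal X ->
     (forall x : X, nonempty_compact_sets (phi x)) ->
     lsc phi -> convex_valued phi ->
     exists f : X -> E, continuous f /\ selection phi f)
  <->
  (forall (X : topologicalType) (phi : X -> set E),
     collectionwise_normal X ->
     (forall x : X, nonempty_compact_sets_or_full (phi x)) ->
     lsc phi -> convex_valued phi ->
     exists f : X -> E, continuous f /\ selection phi f).
Proof.
split=> [_|full] X phi cwnX phiC lphi cphi.
  exact: selection_compact_or_full.
by apply: full => // x; left; exact: phiC.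
Qed.
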